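(* Fix constants $\alpha>0$, $\beta>0$ and $0<\epsilon<\epsilon_s$, and suppose $$\eta:=\max\{1+(\epsilon-\epsilon_s)/2,\ \epsilon_s\}<1.$$ Run the algorithm SELECT described in the context with $s(n):=\min\{\lceil\alpha n^{\epsilon_s}\rceil,n-1\}$ and $g(n):=(\beta s(n)n^{\epsilon})^{1/2}$. There exists a constant $\gamma_\eta>0$ such that the following holds. For every $n\ge1$, every $1\le k\le n$, and every input list $X$ of size $n$, the expected number $C_{nk}$ of comparisons made by SELECT$(X,k)$ satisfies $$C_{nk}\le n+\min\{k,n-k\}+\gamma_\eta n^{\eta}.$$
   Context: Algorithm SELECT$(X,k)$. The input is a list $X$ of $n$ elements of a totally ordered set (repeated values allowed) and an integer $1\le k\le n$. It returns the $k$th smallest element. The sample size $s=s(n)$ and gap $g=g(n)>0$ are given functions with $1\le s(n)\le n-1$ for $n\ge2$. 1. If $n=1$, return the single element. Otherwise set $s:=s(n)$ and $g:=g(n)$. 2. Choose a set of $s$ positions of $X$ uniformly at random among all $s$-subsets, independently of all other random choices. Let $S$ be the sub-list at those positions. 3. Set $i_u:=\max\{\lceil ks/n-g\rceil,1\}$ and $i_v:=\min\{\lceil ks/n+g\rceil,s\}$. Find $u$, the $i_u$th smallest element of $S$, by the recursive call SELECT$(S,i_u)$. If $i_v>i_u$, find $v$ as the $(i_v-i_u)$th smallest element of the sub-list of $S$ formed by its $s-i_u$ largest elements, by a recursive call of SELECT; otherwise set $v:=u$. - It is assumed that each call identifies, without extra comparisons, which elements form the $k$ smallest. - It is assumed that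 after Step 3 the relation of every sample element to $u$ and to $v$ is known without further comparisons. 4. Each element $x$ of $X$ not in the sample is compared with the pivots. - If $k<n/2$: $x$ is compared with $v$ first, and with $u$ only if $x<v$ and $u<v$. - If $k\ge n/2$: $x$ is compared with $u$ first, and with $v$ only if $x>u$ and $u<v$. This yields $L=\{x<u\}$, $U=\{x=u\}$, $M=\{u<x<v\}$, $V=\{x=v\}$ and $R=\{x>v\}$. 5. If $|L|<k\le|L\cup U|$, return $u$. If $|L\cup U\cup M|<k\le n-|R|$, return $v$. 6. If $k\le|L|$, set $\hat X:=L$ and $\hat k:=k$. Else if $n-|R|<k$, set $\hat X:=R$ and $\hat k:=k-n+|R|$. Else set $\hat X:=M$ and $\hat k:=k-|L\cup U|$. 7. Return SELECT$(\hat X,\hat k)$. The comparisons counted are those of Step 4 together with those of all recursive calls. The expectation is over all random sample choices. *)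

(* Defs.v *)
From mathcomp Require Import all_boot all_order all_algebra.
From mathcomp Require Import reals exp.

Set Implicit Arguments.
Unset Strict Implicit.
Unset Printing Implicit Defensive.

Import Order.TTheory GRing.Theory Num.Theory.
Local Open Scope ring_scope.

Section Select.
Variable R : realType.
Variables (alpha beta eps eps_s : R).

Definition int_pos (z : int) : nat := if (z <= 0)%R then 0%N else `|z|%N.

Definition ssize (n : nat) : nat :=
  minn (int_pos (Num.ceil (alpha * (n%:R `^ eps_s)))) n.-1.

Definition sgap (n : nat) : R :=
  Num.sqrt (beta * (ssize n)%:R * (n%:R `^ eps)).

Definition idx_u (n k : nat) : nat :=
  maxn (int_pos (Num.ceil (k%:R * (ssize n)%:R / n%:R - sgap n))) 1.

Definition idx_v (n k : nat) : nat :=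
  minn (int_pos (Num.ceil (k%:R * (ssize n)%:R / n%:R + sgap n))) (ssize n).

Variables (d : Order.disp_t) (T : orderType d).

Definition sublist (X : seq T) (A : {set 'I_(size X)}) : seq T :=
  mask [seq i \in A | i <- enum 'I_(size X)] X.
Definition cosublist (X : seq T) (A : {set 'I_(size X)}) : seq T :=
  mask [seq i \notin A | i <- enum 'I_(size X)] X.

(* Number of comparisons made in Step 4 for one non-sample element x *)
Definition step4_one (n k : nat) (u v x : T) : nat :=
  if (k.*2 < n)%N then
    (1 + ((x < v)%O && (u < v)%O))%N
  else
    (1 + ((u < x)%O && (u < v)%O))%N.

(* Expected number of comparisons of SELECT(X, k), defined by recursion on
   a fuel argument; the genuine value is obtained with fuel = size X
   (every recursive call is on a strictly shorter list).  The expectation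
   over the uniform choice of an s-subset of positions is written as the
   average over all s-subsets A of 'I_n. *)
Fixpoint sel_cost (f : nat) (X : seq T) (k : nat) {struct f} : R :=
  match f with
  | 0%N => 0
  | f'.+1 =>
    match X with
    | [::] => 0
    | x0 :: _ =>
      let n := size X in
      if (n <= 1)%N then 0 else
      let s := ssize n in
      let iu := idx_u n k in
      let iv := idx_v n k in
      (\sum_(A : {set 'I_n} | #|A| == s)
        (let S := sublist A in
         let sS := sort <=%O S in
         let u := nth x0 sS iu.-1 in
         let v := nth x0 sS iv.-1 in
         let c3 := sel_cost f' S iu +
                   (if (iu < iv)%N then sel_cost f' (drop iu sS) (iv - iu) else 0) in
         let c4 := (\sum_(x <- cosublist A) step4_one n k u v x)%N in
         let L := [seq x <- X | (x < u)%O] in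
         let U := [seq x <- X | x == u] in
         let M := [seq x <- X | (u < x)%O && (x < v)%O] in
         let Rr := [seq x <- X | (v < x)%O] in
         let lL := size L in
         let lLU := (size L + size U)%N in
         let lLUM := (size L + size U + size M)%N in
         let c7 :=
           if (lL < k <= lLU)%N then 0
           else if (lLUM < k <= n - size Rr)%N then 0
           else if (k <= lL)%N then sel_cost f' L k
           else if (n - size Rr < k)%N then sel_cost f' Rr (k - (n - size Rr))
           else sel_cost f' M (k - lLU) in
         c3 + c4%:R + c7)) / ('C(n, s))%:R
    end
  end.

Definition select_cost (X : seq T) (k : nat) : R := sel_cost (size X) X k.

End Select.

(* Main.v *)
Require Import Defs.
From mathcomp Require Import all_boot all_order all_algebra.
From mathcomp Require Import reals sequences exp.
From mathcomp Require Import ring lra zify.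

Set Implicit Arguments.
Unset Strict Implicit.
Unset Printing Implicit Defensive.

Import Order.TTheory GRing.Theory Num.Theory.
Local Open Scope ring_scope.

(* With [n = size X], [s = ssize n], [g = sgap n] and [q = g n / s], the number of
   sample positions falling in a fixed set of positions is hypergeometric, so it
   deviates from its mean by at least [g] with probability at most
   [expR (- g ^ 2 / (8 s)) = expR (- beta n ^ eps / 8) = O(1 / n)].  Applying this
     to
   the sets of positions whose values lie below (or at most at) the elements of
   suitable ranks, outside four such bad events Step 4 makes at most
   [n + min (k, n - k) + 2 q] comparisons and Step 7 recurses on at most [4 q]
   elements.  As [s] and [q] are both [O(n ^ eta)] with [eta < 1], a bound
   [m + min (j, m - j) + gamma m ^ eta] on the recursive calls contributes only
   [O(n ^ eta) + gamma O(n ^ (eta ^ 2))] to the cost, so the bound propagates for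
   [n] large and [gamma] large; [gamma] also absorbs the finitely many small [n]. *)

(** * Binomial coefficient inequalities *)

(** Factor by factor, [(m - j) * n <= (n - j) * m] because [j * m <= j * n]; truncated subtraction
    does no harm. *)
Lemma ffact_mul_exp_le (m n i : nat) :
  (m <= n)%N -> (m ^_ i * n ^ i <= n ^_ i * m ^ i)%N.
Proof.
move=> lemn; elim: i => [|i IHi]; first by rewrite !ffactn0 !expn0.
rewrite !ffactnSr !expnSr mulnACA [leqRHS]mulnACA leq_mul //.
by rewrite !mulnBl [(n * m)%N]mulnC leq_sub2l // leq_mul2l lemn orbT.
Qed.

Lemma bin_mul_exp_le (m n i : nat) :
  (m <= n)%N -> ('C(m, i) * n ^ i <= 'C(n, i) * m ^ i)%N.
Proof.
move=> /(ffact_mul_exp_le i); rewrite -!bin_ffact.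
by rewrite mulnAC [leqRHS]mulnAC leq_pmul2r ?fact_gt0.
Qed.

(** Double counting of the [i]-sets inside [s]-sets. Starting from the [i]-set, the complement of
    the [s]-set is what gets chosen, which matches [card_supersets]. *)
Lemma bin_mul_bin (n s i : nat) : (i <= s)%N -> (s <= n)%N ->
  ('C(n, s) * 'C(s, i) = 'C(n, i) * 'C(n - i, n - s))%N.
Proof.
move=> leis lesn; have lein := leq_trans leis lesn.
have lens : (n - s <= n - i)%N by rewrite leq_sub2l.
have E1 := bin_fact lesn; have E2 := bin_fact leis.
have E3 := bin_fact lein; have E4 := bin_fact lens.
have E5 : (n - i - (n - s) = s - i)%N by lia.
rewrite E5 in E4.
have f1 := fact_gt0 i; have f2 := fact_gt0 (s - i); have f3 := fact_gt0 (n - s).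
apply/eqP; rewrite -(eqn_pmul2r (_ : 0 < i`! * ((s - i)`! * (n - s)`!))%N)
  ?muln_gt0 ?f1 ?f2 ?f3 //.
apply/eqP; transitivity n`!.
  by rewrite -E1 -E2; ring.
by rewrite -E3 -E4; ring.
Qed.

(** After division by ['C(n, s) * n ^ i], this compares the [i]th binomial moment of the
    hypergeometric law with that of the binomial law of parameters [s] and [m / n]. *)
Lemma bin_hypergeometric_le (n s m i : nat) :
  (m <= n)%N -> (s <= n)%N -> (i <= n)%N ->
  ('C(n - i, n - s) * 'C(m, i) * n ^ i <= 'C(n, s) * 'C(s, i) * m ^ i)%N.
Proof.
move=> lemn lesn lein; case: (leqP i s) => [leis|ltsi]; last first.
  by rewrite bin_small //; lia.
rewrite bin_mul_bin // -mulnA [leqRHS](_ : _ = 'C(n - i, n - s) * ('C(n, i) * m ^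
  i))%N; last by ring.
by rewrite leq_mul2l bin_mul_exp_le ?orbT.
Qed.

(** * Sums over subsets and counting of supersets *)

Section SubsetSums.
Variables (V : nmodType) (T : finType).

(** The range [N] is decoupled from [#|B|] so that the sums for [A :&: P] and for [P] can all run up
    to [#|T|]. *)
Lemma sum_subset_card (B : {set T}) (F : nat -> V) (N : nat) :
  (#|B| <= N)%N ->
  \sum_(D : {set T} | D \subset B) F #|D| = \sum_(i < N.+1) F i *+ 'C(#|B|, i).
Proof.
move=> leBN.
rewrite (partition_big (fun D : {set T} => inord #|D| : 'I_N.+1) predT) //=.
apply: eq_bigr => i _; rewrite -cards_draws -sumr_const.
have DN (D : {set T}) : D \subset B -> (#|D| < N.+1)%N.
  by move=> /subset_leq_card DB; rewrite ltnS (leq_trans DB).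
apply: eq_big => [D|D].
  rewrite inE; case: (boolP (D \subset B)) => //= DB.
  by rewrite -val_eqE /= inordK ?DN.
by move=> /andP[DB /eqP <-]; rewrite inordK ?DN.
Qed.

(** Complementation turns supersets of [D] into subsets of [~: D]. *)
Lemma card_supersets (D : {set T}) (s : nat) : (s <= #|T|)%N ->
  #|[set A : {set T} | D \subset A & #|A| == s]| = 'C(#|T| - #|D|, #|T| - s).
Proof.
move=> lesT; have cT := cardsC D.
rewrite (_ : (#|T| - #|D|)%N = #|~: D|); last by lia.
rewrite -cards_draws -(card_imset _ (@setC_inj T)); apply: eq_card => A.
rewrite !inE; apply/imsetP/andP => [[A0 + ->]|[AD /eqP cA]].
  rewrite inE setCS => /andP[-> /eqP <-]; split=> //.
  by have := cardsC A0; lia.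
exists (~: A); rewrite ?setCK // inE -setCS setCK AD /=.
by have := cardsC A; lia.
Qed.
End SubsetSums.

(** * Exponential tail bounds for the hypergeometric law *)

Section HypergeometricTail.
Variables (R : realType) (T : finType).
Implicit Types (A P : {set T}) (s : nat).

Lemma exprD1_widen (x : R) (s N : nat) : (s <= N)%N ->
  (1 + x) ^+ s = \sum_(i < N.+1) x ^+ i *+ 'C(s, i).
Proof.
move=> lesN; rewrite exprDn (big_ord_widen _ (fun i => 1 ^+ (s - i) * x ^+ i *+
  'C(s, i)) (_ : s.+1 <= N.+1)%N) //.
rewrite big_mkcond /=; apply: eq_bigr => i _; rewrite expr1n mul1r ltnS.
by case: leqP => // /bin_small ->; rewrite mulr0n.
Qed.

(* The factorial moments E ['C(H, i)] of the hypergeometric law are dominated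
   by those of the binomial law; expanding [(1 + x) ^+ H] in them compares the
   generating functions. *)
Lemma hypergeometric_mgf_le P s (x : R) : 0 <= x -> (s <= #|T|)%N ->
  \sum_(A : {set T} | #|A| == s) (1 + x) ^+ #|A :&: P| <=
  'C(#|T|, s)%:R * (1 + #|P|%:R / #|T|%:R * x) ^+ s.
Proof.
move=> x0 lesT; have leP : (#|P| <= #|T|)%N := max_card _.
under eq_bigr => A _ do rewrite (exprD1_widen x (max_card _)) -(sum_subset_card
  (GRing.exp x) (max_card _)).
(* After the exchange, each [D] inside [P] collects the [s]-sets containing it. *)
rewrite (exchange_big_dep (fun D : {set T} => D \subset P)) /=; last first.
  by move=> A D _; rewrite subsetI => /andP[].
rewrite (eq_bigr (fun D : {set T} => x ^+ #|D| *+ 'C(#|T| - #|D|, #|T| - s))); last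
  first.
  move=> D DP; rewrite -card_supersets // -sumr_const; apply: eq_bigl => A.
  by rewrite inE subsetI DP andbT andbC.
rewrite (sum_subset_card (fun i => x ^+ i *+ 'C(#|T| - i, #|T| - s)) leP).
rewrite (exprD1_widen _ lesT) mulr_sumr; apply: ler_sum => i _.
rewrite -mulrnA -(mulr_natr (x ^+ i)) -(mulr_natr (_ ^+ _) 'C(s, i)) !exprMn exprVn.
have [i0|i0] := posnP i.
  rewrite i0 !expr0 !bin0 muln1 !mulr1 !mul1r subn0 bin_sub //.
  by rewrite invr1 mulr1.
case: (posnP #|T|) => [T0|T0].
  by have := ltn_ord i; lia.
have Tn : (0 : R) < #|T|%:R ^+ i by rewrite exprn_gt0 // ltr0n.
rewrite [leRHS](_ : _ = ('C(#|T|, s) * 'C(s, i) * #|P| ^ i)%:R * x ^+ i / #|T|%:R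
  ^+ i); last first.
  by rewrite !natrM natrX; ring.
rewrite ler_pdivlMr // mulrAC -mulrA mulrC ler_wpM2r ?exprn_ge0 //.
rewrite -natrX -natrM ler_nat mulnC.
by apply: bin_hypergeometric_le => //; rewrite -ltnS.
Qed.

(** From [expR (- h) >= 1 - h] follows [(1 - h) * expR h <= 1], and [(1 - h) * (1 + h + 2 * h ^+ 2)
    - 1 = h ^+ 2 * (1 - 2 * h)] is nonnegative. *)
Lemma expR_le_quadratic (h : R) : 0 <= h -> h <= 1 / 2 ->
  expR h <= 1 + h + 2 * h ^+ 2.
Proof.
move=> h0 h1; have := expR_ge1Dx (- h); rewrite expRN => H.
have E0 := expR_gt0 h.
have H2 : (1 - h) * expR h <= 1 by rewrite -ler_pdivlMr // div1r.
have H3 : 0 <= h ^+ 2 * (1 - 2 * h) by rewrite mulr_ge0 ?sqr_ge0 //; lra.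
have H4 : 0 < 1 - h by lra.
rewrite -(ler_pM2l H4) (le_trans H2) //.
by move: H3; rewrite (_ : h ^+ 2 * (1 - 2 * h) = (1 - h) * (1 + h + 2 * h ^+ 2) -
  1); [lra|ring].
Qed.

(** Chernoff's method: the indicator is at most [expR (h * (#|A :&: P| - t))], whose mean is bounded
    through [hypergeometric_mgf_le] with [1 + x = expR h]. *)
Lemma hypergeometric_tail P s (g t : R) :
  (0 < s)%N -> (s <= #|T|)%N -> 0 <= g -> s%:R * #|P|%:R / #|T|%:R + g <= t ->
  \sum_(A : {set T} | #|A| == s) (t <= #|A :&: P|%:R)%R%:R <=
  'C(#|T|, s)%:R * expR (- (g ^+ 2 / (8 * s%:R))).
Proof.
move=> s0 lesT g0 tge.
have sR : (0 : R) < s%:R by rewrite ltr0n.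
have TR : (0 : R) < #|T|%:R by rewrite ltr0n (leq_trans s0).
have p0 : 0 <= #|P|%:R / #|T|%:R :> R by rewrite divr_ge0.
have p1 : #|P|%:R / #|T|%:R <= 1 :> R.
  by rewrite ler_pdivrMr // mul1r ler_nat max_card.
rewrite -mulrA in tge; set p := #|P|%:R / #|T|%:R in p0 p1 tge.
have sp0 : 0 <= s%:R * p by rewrite mulr_ge0 // ltW.
(* For [g > s] the threshold exceeds the sample size and the event is empty. *)
case: (lerP g s%:R) => [legs|ltsg]; last first.
  rewrite big1 ?mulr_ge0 ?expR_ge0 // => A /eqP cA.
  have : (#|A :&: P|%:R : R) <= s%:R by rewrite ler_nat -cA subset_leq_card
    ?subsetIl.
  by case: (lerP t) => [|_ _]; [lra|by rewrite mulr0n].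
(* This [h] minimises the final exponent [2 * s * h ^+ 2 - g * h]. *)
set h := g / (4 * s%:R).
have h0 : 0 <= h by rewrite divr_ge0 // mulr_ge0 // ltW.
have h1 : h <= 1 / 2 by rewrite ler_pdivrMr ?mulr_gt0 //; lra.
have x0 : 0 <= expR h - 1 by rewrite subr_ge0 -expR0 ler_expR.
apply: (@le_trans _ _ (\sum_(A : {set T} | #|A| == s) (1 + (expR h - 1)) ^+ #|A :&:
  P| * expR (- (h * t)))).
  apply: ler_sum => A _; rewrite addrC subrK -expRM_natl -expRD.
  case: (lerP t) => [H|_] /=; last by rewrite mulr0n expR_ge0.
  by rewrite mulr1n -[leLHS]expR0 ler_expR; have := ler_wpM2l h0 H; lra.
rewrite -mulr_suml; apply: (le_trans (ler_wpM2r (expR_ge0 _) (hypergeometric_mgf_le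
  P x0 lesT))).
rewrite -/p -[leLHS]mulrA; apply: ler_wpM2l => //.
have B : 1 + p * (expR h - 1) <= expR (p * h + 2 * h ^+ 2).
  apply: le_trans (expR_ge1Dx _); rewrite lerD2l.
  have H := expR_le_quadratic h0 h1.
  apply: (@le_trans _ _ (p * (h + 2 * h ^+ 2))).
    by apply: ler_wpM2l => //; lra.
  by rewrite mulrDr lerD2l ler_piMl // mulr_ge0 // sqr_ge0.
apply: (@le_trans _ _ (expR (p * h + 2 * h ^+ 2) ^+ s * expR (- (h * t)))).
  rewrite ler_wpM2r ?expR_ge0 // lerXn2r // nnegrE ?expR_ge0 //.
  by rewrite addr_ge0 // mulr_ge0.
rewrite -expRM_natl -expRD ler_expR.
have H := ler_wpM2l h0 tge.
have -> : g ^+ 2 / (8 * s%:R) = h * g - 2 * h ^+ 2 * s%:R.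
  by rewrite /h; field; apply/lt0r_neq0.
by lra.
Qed.

(** The upper tail applied to [~: P], which meets the sample in [s - #|A :&: P|] points. *)
Lemma hypergeometric_tail_low P s (g t : R) :
  (0 < s)%N -> (s <= #|T|)%N -> 0 <= g -> t <= s%:R * #|P|%:R / #|T|%:R - g ->
  \sum_(A : {set T} | #|A| == s) (#|A :&: P|%:R <= t)%R%:R <=
  'C(#|T|, s)%:R * expR (- (g ^+ 2 / (8 * s%:R))).
Proof.
move=> s0 lesT g0 tle.
have TR : (0 : R) < #|T|%:R by rewrite ltr0n (leq_trans s0).
apply: le_trans (@hypergeometric_tail (~: P) s g (s%:R - t) s0 lesT g0 _).
  apply: ler_sum => A /eqP cA; rewrite ler_nat.
  have : (#|A :&: P|%:R + #|A :&: ~: P|%:R = s%:R :> R).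
    by rewrite -natrD -cA -(cardsID P A) setDE.
  by move=> H; case: lerP => // H1; case: lerP => // H2; lra.
rewrite cardsCs setCK natrB ?max_card // mulrBr mulrBl mulfK ?lt0r_neq0 //.
by lra.
Qed.

End HypergeometricTail.

(** * Order statistics and counts inside a sample *)

Section OrderStatistics.
Variables (d : Order.disp_t) (T : orderType d).
Implicit Types (X Y : seq T) (p : pred T).

Lemma count_lt_nth_sort (x0 : T) Y i :
  (count (< nth x0 (sort <=%O Y) i)%O Y <= i)%N.
Proof.
rewrite leqNgt -(count_sort <=%O); apply/negP.
by move=> /(nth_count_lt x0 (sort_le_sorted Y)); rewrite ltxx.
Qed.

Lemma count_le_nth_sort (x0 : T) Y i : (i < size Y)%N ->
  (i < count (<= nth x0 (sort <=%O Y) i)%O Y)%N.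
Proof.
move=> iY; rewrite ltnNge -(count_sort <=%O); apply/negP => H.
have := @nth_count_gt _ _ (nth x0 (sort <=%O Y) i) x0 _ i (sort_le_sorted Y).
by rewrite H size_sort iY ltxx => /(_ isT).
Qed.

Lemma nth_sort_gt (x0 x : T) Y i : (i < size Y)%N ->
  (count (<= x)%O Y <= i)%N -> (x < nth x0 (sort <=%O Y) i)%O.
Proof.
move=> iY; rewrite -(count_sort <=%O) => H.
by apply: nth_count_gt; rewrite ?sort_le_sorted // H size_sort.
Qed.

Lemma nth_sort_lt (x0 x : T) Y i :
  (i < count (< x)%O Y)%N -> (nth x0 (sort <=%O Y) i < x)%O.
Proof.
rewrite -(count_sort <=%O) => H; exact: nth_count_lt.
Qed.

(** Positions rather than values, so that repeated elements count with multiplicity. *)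
Definition positions p X : {set 'I_(size X)} :=
  [set i | p (tnth (in_tuple X) i)].

Lemma sublistE X (A : {set 'I_(size X)}) :
  sublist A = [seq tnth (in_tuple X) i | i <- [seq i <- enum 'I_(size X) | i \in
    A]].
Proof.
rewrite /sublist filter_mask map_mask; congr mask.
by rewrite [RHS]map_tnth_enum.
Qed.

Lemma cosublistE X (A : {set 'I_(size X)}) : cosublist A = sublist (~: A).
Proof.
by rewrite /cosublist /sublist; congr mask; apply: eq_map => i; rewrite inE.
Qed.

(** The bridge to the tail bounds: ranks in the sample become hypergeometric intersection sizes. *)
Lemma count_sublist X (A : {set 'I_(size X)}) p :
  count p (sublist A) = #|A :&: positions p X|.
Proof.
rewrite sublistE count_map count_filter enumT -size_filter cardE.
rewrite /enum_mem size_filter size_filter; apply: eq_count => i /=.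
by rewrite !inE andbC.
Qed.

Lemma size_sublist X (A : {set 'I_(size X)}) : size (sublist A) = #|A|.
Proof.
rewrite -(count_predT (sublist A)) count_sublist; apply: eq_card => i.
by rewrite !inE andbT.
Qed.

Lemma sublist_setT X : sublist [set: 'I_(size X)] = X.
Proof.
by rewrite sublistE (eq_filter (a2 := predT)) ?filter_predT ?map_tnth_enum // => i;
  rewrite inE.
Qed.

Lemma card_positions p X : #|positions p X| = count p X.
Proof. by have := count_sublist [set: 'I_(size X)] p; rewrite sublist_setT setTI.
  Qed.

Lemma count_sublist_le X (A : {set 'I_(size X)}) p :
  (count p (sublist A) <= count p X)%N.
Proof. exact: leq_count_mask. Qed.

Lemma mem_nth_sort_sublist (x0 : T) X (A : {set 'I_(size X)}) i :
  x0 \in X -> nth x0 (sort <=%O (sublist A)) i \in X.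
Proof.
move=> x0X; case: (ltnP i (size (sublist A))) => [iS|iS]; last first.
  by rewrite nth_default // size_sort.
have : nth x0 (sort <=%O (sublist A)) i \in sublist A.
  by rewrite -(mem_sort <=%O) mem_nth // size_sort.
exact: mem_mask.
Qed.

End OrderStatistics.

(** * Ranks of the pivots in the sample *)

Section Indices.
Variable R : realType.

(** Cutting negative ceilings to 0 is invisible to comparisons [m < _] with [m] natural. *)
Lemma lt_int_pos_ceil (m : nat) (y : R) :
  (m < int_pos (Num.ceil y))%N = (m%:R < y).
Proof.
rewrite -(ceil_gt_int y m%:Z) /int_pos.
by case: (Num.ceil y) => [[|z]|z].
Qed.

Lemma int_pos_ceil_le (m : nat) (y : R) :
  (int_pos (Num.ceil y) <= m)%N = (y <= m%:R).
Proof. by rewrite leqNgt lt_int_pos_ceil -leNgt. Qed.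

Lemma le_int_pos_ceil (y : R) : y <= (int_pos (Num.ceil y))%:R.
Proof. by rewrite -int_pos_ceil_le. Qed.

Lemma ssize_gt0 (alpha eps_s : R) (n : nat) :
  0 < alpha -> (1 < n)%N -> (0 < ssize alpha eps_s n)%N.
Proof.
move=> alpha0 n1; rewrite leq_min; apply/andP; split; last by lia.
by rewrite lt_int_pos_ceil mulr_gt0 // powR_gt0 // ltr0n; lia.
Qed.

Lemma ssize_lt (alpha eps_s : R) (n : nat) : (1 < n)%N -> (ssize alpha eps_s n <
  n)%N.
Proof.
by move=> n1; have H : (ssize alpha eps_s n <= n.-1)%N := geq_minr _ _; lia.
Qed.

Variables (alpha beta eps eps_s : R).
Hypothesis alpha0 : 0 < alpha.
Variables (n k : nat).
Hypothesis n1 : (1 < n)%N.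
Hypothesis kn : (1 <= k <= n)%N.

Let s := ssize alpha eps_s n.
Let g := sgap alpha beta eps eps_s n.
Let t : R := k%:R * s%:R / n%:R.
Let iu := idx_u alpha beta eps eps_s n k.
Let iv := idx_v alpha beta eps eps_s n k.

Lemma sgap_ge0 : 0 <= g.
Proof. exact: sqrtr_ge0. Qed.

Lemma target_gt0 : 0 < t.
Proof.
rewrite divr_gt0 ?mulr_gt0 // ltr0n ?ssize_gt0 //; [by case/andP: kn|].
exact: ltn_trans n1.
Qed.

Lemma target_le : t <= s%:R.
Proof.
have nR : (0 : R) < n%:R by rewrite ltr0n; lia.
by rewrite ler_pdivrMr // mulrC ler_wpM2l // ler_nat; case/andP: kn.
Qed.

Lemma idx_u_gt0 : (0 < iu)%N.
Proof. by rewrite leq_max orbT. Qed.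

Lemma idx_u_le : (iu <= s)%N.
Proof.
rewrite geq_max ssize_gt0 // andbT int_pos_ceil_le.
by have := target_le; have := sgap_ge0; rewrite /t /g /s; lra.
Qed.

Lemma idx_v_le : (iv <= s)%N.
Proof. exact: geq_minr. Qed.

Lemma idx_u_le_v : (iu <= iv)%N.
Proof.
rewrite leq_min idx_u_le andbT geq_max.
have := target_gt0; have := sgap_ge0; rewrite /t /g /s => H1 H2.
apply/andP; split; last by rewrite lt_int_pos_ceil; lra.
by rewrite int_pos_ceil_le; apply: le_trans (le_int_pos_ceil _); lra.
Qed.

Lemma idx_u_ge : t - g <= iu%:R.
Proof.
by rewrite -int_pos_ceil_le leq_maxl.
Qed.

(** The condition [g < t] says that the lower clamp at 1 does not raise [iu]; in [idx_v_ge],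
    [t + g <= s] plays the same role for the upper clamp at [s]. *)
Lemma idx_u_lt (m : nat) : g < t -> (m < iu)%N -> m%:R < t - g.
Proof.
move=> gt; rewrite leq_max lt_int_pos_ceil => /orP[//|].
by rewrite ltnS leqn0 => /eqP ->; rewrite subr_gt0.
Qed.

Lemma idx_v_lt (m : nat) : (m < iv)%N -> m%:R < t + g.
Proof. by rewrite leq_min lt_int_pos_ceil => /andP[]. Qed.

Lemma idx_v_ge : t + g <= s%:R -> t + g <= iv%:R.
Proof.
by rewrite -[_ <= iv%:R]int_pos_ceil_le leq_min leqnn -int_pos_ceil_le => ->.
Qed.

End Indices.

(** * Cost of one round for a fixed sample *)

Section Round.
Variables (R : realType) (alpha beta eps eps_s : R).
Variables (d : Order.disp_t) (T : orderType d).

(* The summand of [sel_cost], with the recursive calls abstracted as [cost]. *)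
Definition sel_round (cost : seq T -> nat -> R) (x0 : T) (X : seq T) (k : nat)
    (A : {set 'I_(size X)}) : R :=
  let n := size X in
  let iu := idx_u alpha beta eps eps_s n k in
  let iv := idx_v alpha beta eps eps_s n k in
  let S := sublist A in
  let sS := sort <=%O S in
  let u := nth x0 sS iu.-1 in
  let v := nth x0 sS iv.-1 in
  let c3 := cost S iu +
            (if (iu < iv)%N then cost (drop iu sS) (iv - iu)%N else 0) in
  let c4 := (\sum_(x <- cosublist A) step4_one n k u v x)%N in
  let L := [seq x <- X | (x < u)%O] in
  let U := [seq x <- X | x == u] in
  let M := [seq x <- X | (u < x)%O && (x < v)%O] in
  let Rr := [seq x <- X | (v < x)%O] in
  let lL := size L in
  let lLU := (size L + size U)%N in
  let lLUM := (size L + size U + size M)%N in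
  let c7 :=
    if (lL < k <= lLU)%N then 0
    else if (lLUM < k <= n - size Rr)%N then 0
    else if (k <= lL)%N then cost L k
    else if (n - size Rr < k)%N then cost Rr (k - (n - size Rr))%N
    else cost M (k - lLU)%N in
  c3 + c4%:R + c7.

Lemma sel_costS (f : nat) (x0 : T) (X : seq T) (k : nat) :
  sel_cost alpha beta eps eps_s f.+1 (x0 :: X) k =
  if (size (x0 :: X) <= 1)%N then 0 else
  (\sum_(A : {set 'I_(size (x0 :: X))} | #|A| == ssize alpha eps_s (size (x0 :: X)))
     sel_round (sel_cost alpha beta eps eps_s f) x0 k A)
  / 'C(size (x0 :: X), ssize alpha eps_s (size (x0 :: X)))%:R.
Proof. by []. Qed.

Lemma size_cosublist (X : seq T) (A : {set 'I_(size X)}) :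
  (size (cosublist A) <= size X)%N.
Proof. by rewrite cosublistE size_sublist -[leqRHS]card_ord max_card. Qed.

Lemma step4_sum_le2 (n k : nat) (u v : T) (X : seq T) (A : {set 'I_(size X)}) :
  (\sum_(x <- cosublist A) step4_one n k u v x <= (size X).*2)%N.
Proof.
apply: (@leq_trans (\sum_(x <- cosublist A) 2)%N).
  by apply: leq_sum => x _; rewrite /step4_one; case: ifP => _; case: (_ && _).
by rewrite big_const_seq count_predT iter_addn_0 mul2n leq_double size_cosublist.
Qed.

(** The order of comparisons makes second comparisons fall on the shorter side: for good pivots
    about [k] elements lie below [v] and about [n - k] above [u]. *)
Lemma step4_sum_le (n k : nat) (u v : T) (X : seq T) (A : {set 'I_(size X)}) :
  (\sum_(x <- cosublist A) step4_one n k u v x <=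
     size X + if (k.*2 < n)%N then count (< v)%O X else count (> u)%O X)%N.
Proof.
have H (p : pred T) : (\sum_(x <- cosublist A) (1 + p x) <= size X + count p X)%N.
  rewrite big_split /= sum1_size leq_add ?size_cosublist //.
  by rewrite -big_mkcond /= sum1_count cosublistE count_sublist_le.
rewrite /step4_one; case: ifP => _; apply: leq_trans (H _); apply: leq_sum => x _.
  by rewrite leq_add2l /=; case: (x < v)%O; case: (u < v)%O.
by rewrite leq_add2l /=; case: (u < x)%O; case: (u < v)%O.
Qed.

(** Both pivots belong to [X] and each list of Step 7 omits one of them, so the two calls of Step 3
    and the one of Step 7 are all on shorter lists. *)
Lemma sel_round_crude (cost : seq T -> nat -> R) (c : R) (x0 : T)
    (X : seq T) (k : nat) (A : {set 'I_(size X)}) :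
  0 <= c -> x0 \in X -> (#|A| < size X)%N ->
  (forall Y j, (size Y < size X)%N -> cost Y j <= c) ->
  sel_round cost x0 k A <= 3 * c + 2 * (size X)%:R.
Proof.
move=> c0 x0X AX H; rewrite /sel_round.
set iu := idx_u _ _ _ _ _ _; set iv := idx_v _ _ _ _ _ _.
set u := nth _ _ iu.-1; set v := nth _ _ iv.-1.
have uX : u \in X by exact: mem_nth_sort_sublist.
have vX : v \in X by exact: mem_nth_sort_sublist.
have lt_filter (p : pred T) x : x \in X -> ~~ p x -> (size [seq y <- X | p y] <
  size X)%N.
  move=> xX px; rewrite size_filter -(count_predC p X) -[ltnLHS]addn0 ltn_add2l.
  by rewrite -has_count; apply/hasP; exists x.
have h1 : cost (sublist A) iu <= c by apply: H; rewrite size_sublist.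
have h2 : (if (iu < iv)%N then cost (drop iu (sort <=%O (sublist A))) (iv - iu)%N
  else 0) <= c.
  case: ifP => // _; apply: H; rewrite size_drop size_sort size_sublist.
  exact: leq_ltn_trans (leq_subr _ _) AX.
have h4 : (\sum_(x <- cosublist A) step4_one (size X) k u v x)%:R <= 2 * (size
  X)%:R :> R.
  by rewrite -natrM ler_nat mul2n step4_sum_le2.
set c7 := (X in _ + X <= _).
have h7 : c7 <= c.
  rewrite /c7; case: ifP => // _; case: ifP => // _.
  case: ifP => _; last case: ifP => _; apply: H.
  - by apply: (lt_filter _ u); rewrite //= ltxx.
  - by apply: (lt_filter _ v); rewrite //= ltxx.
  - by apply: (lt_filter _ u); rewrite //= ltxx.
by lra.
Qed.

End Round.

(** * Bad samples, their probability, and the pivots of good samples *)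

Section Sampling.
Variables (R : realType) (alpha beta eps eps_s : R).
Hypothesis alpha0 : 0 < alpha.
Variables (d : Order.disp_t) (T : orderType d) (x0 : T) (X : seq T) (k : nat).
Hypothesis n1 : (1 < size X)%N.
Hypothesis kn : (1 <= k <= size X)%N.

Let n := size X.
Let s := ssize alpha eps_s n.
Let g := sgap alpha beta eps eps_s n.
Let t : R := k%:R * s%:R / n%:R.
Let q : R := g * n%:R / s%:R.
Let iu := idx_u alpha beta eps eps_s n k.
Let iv := idx_v alpha beta eps eps_s n k.

Let s0 : (0 < s)%N. Proof. exact: ssize_gt0. Qed.
Let sn : (s < n)%N. Proof. exact: ssize_lt. Qed.
Let g0 : 0 <= g. Proof. exact: sqrtr_ge0. Qed.
Let sR : (0 : R) < s%:R. Proof. by rewrite ltr0n. Qed.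
Let nR : (0 : R) < n%:R. Proof. by rewrite ltr0n; apply: ltn_trans n1. Qed.
Let q0 : 0 <= q.
Proof. by rewrite divr_ge0 ?mulr_ge0 // ltW. Qed.

(** Ranks are zero-based: the [k]th smallest element is [xrank k.-1]. *)
Definition xrank (i : nat) : T := nth x0 (sort <=%O X) i.
(** A distance [2 * q] in [X] corresponds to [2 * g] sample ranks: one [g] for the offset of the
    pivot index, one for the random deviation. *)
Definition jhigh : nat := Num.trunc (k%:R + 2 * q).
Definition jlow : nat := Num.trunc ((n - k)%:R + 2 * q).

(* The complement of [bad_sample] forces the pivots to straddle the k-th smallest
   element and to lie within [2 q] ranks of it, up to truncation of the sample
   ranks at the two ends. *)
Definition bad_v_small (A : {set 'I_(size X)}) : bool :=
  t + g <= #|A :&: positions (< xrank k.-1)%O X|%:R.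
Definition bad_u_large (A : {set 'I_(size X)}) : bool :=
  #|A :&: positions (<= xrank k.-1)%O X|%:R <= t - g.
Definition bad_v_large (A : {set 'I_(size X)}) : bool :=
  (jhigh < n)%N && (#|A :&: positions (<= xrank jhigh)%O X|%:R <= t + g).
Definition bad_u_small (A : {set 'I_(size X)}) : bool :=
  (jlow < n)%N && (t - g <= #|A :&: positions (< xrank (n - jlow.+1))%O X|%:R).
Definition bad_sample (A : {set 'I_(size X)}) : bool :=
  [|| bad_v_small A, bad_u_large A, bad_v_large A | bad_u_small A].

Let tail : R := expR (- (g ^+ 2 / (8 * s%:R))).

Let cardI : #|'I_(size X)| = n. Proof. exact: card_ord. Qed.
Let sI : (s <= #|'I_(size X)|)%N. Proof. by rewrite cardI ltnW. Qed.

Let scale_rank (x y : R) : x <= y -> s%:R * x / n%:R <= s%:R * y / n%:R.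
Proof.
move=> H; apply: ler_wpM2r; first by rewrite invr_ge0 ltW.
by apply: ler_wpM2l => //; apply: ltW.
Qed.

Let scale_q (y : R) : s%:R * (y + 2 * q) / n%:R = s%:R * y / n%:R + 2 * g.
Proof. by rewrite /q; field; rewrite !lt0r_neq0. Qed.

(** Fewer than [k] elements lie below the [k]th smallest, so the mean is at most [t]. *)
Lemma sum_bad_v_small :
  \sum_(A : {set 'I_(size X)} | #|A| == s) (bad_v_small A)%:R <= 'C(n, s)%:R * tail.
Proof.
rewrite -[in 'C(n, s)]cardI; apply: hypergeometric_tail => //.
rewrite card_positions cardI lerD2r /t [k%:R * _]mulrC; apply: scale_rank.
rewrite ler_nat; apply: leq_trans (count_lt_nth_sort _ _ _) _.
exact: leq_pred.
Qed.

Lemma sum_bad_u_large :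
  \sum_(A : {set 'I_(size X)} | #|A| == s) (bad_u_large A)%:R <= 'C(n, s)%:R * tail.
Proof.
rewrite -[in 'C(n, s)]cardI; apply: hypergeometric_tail_low => //.
rewrite card_positions cardI lerD2r /t [k%:R * _]mulrC; apply: scale_rank.
rewrite ler_nat; have := @count_le_nth_sort _ _ x0 X k.-1.
by case/andP: kn => k1 k2; rewrite prednK //; apply.
Qed.

(** More than [k + 2 * q] elements are at most [xrank jhigh], so the mean is at least [t + 2 * g]
    and the event is a deviation by [g]. *)
Lemma sum_bad_v_large :
  \sum_(A : {set 'I_(size X)} | #|A| == s) (bad_v_large A)%:R <= 'C(n, s)%:R * tail.
Proof.
rewrite /bad_v_large; case: ltnP => [jn|_]; last first.
  by rewrite big1 // mulr_ge0 ?expR_ge0.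
rewrite -[in 'C(n, s)]cardI; apply: hypergeometric_tail_low => //.
rewrite card_positions cardI.
have K0 : 0 <= k%:R + 2 * q by rewrite addr_ge0 // mulr_ge0.
have : k%:R + 2 * q <= (count (<= xrank jhigh)%O X)%:R.
  apply/ltW; rewrite -truncn_lt_nat //; exact: count_le_nth_sort.
by move=> /scale_rank; rewrite scale_q /t mulrAC; lra.
Qed.

Lemma sum_bad_u_small :
  \sum_(A : {set 'I_(size X)} | #|A| == s) (bad_u_small A)%:R <= 'C(n, s)%:R * tail.
Proof.
rewrite /bad_u_small; case: ltnP => [jn|_]; last first.
  by rewrite big1 // mulr_ge0 ?expR_ge0.
rewrite -[in 'C(n, s)]cardI; apply: hypergeometric_tail => //.
rewrite card_positions cardI.
have K0 : 0 <= (n - k)%:R + 2 * q by rewrite addr_ge0 // mulr_ge0.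
have jlt : (n - k)%:R + 2 * q < jlow.+1%:R by rewrite -truncn_lt_nat.
have cle : (count (< xrank (n - jlow.+1))%O X)%:R <= (n - jlow.+1)%:R :> R.
  by rewrite ler_nat count_lt_nth_sort.
have kle : (k <= n)%N by case/andP: kn.
have : (count (< xrank (n - jlow.+1))%O X)%:R <= k%:R + 2 * (- q).
  apply: le_trans cle _; move: jlt; rewrite !natrB //; lra.
move=> /scale_rank.
rewrite (_ : s%:R * (k%:R + _) / n%:R = s%:R * k%:R / n%:R - 2 * g); first by
  rewrite /t mulrAC; lra.
by rewrite /q; field; rewrite !lt0r_neq0.
Qed.

Lemma sum_bad_sample :
  \sum_(A : {set 'I_(size X)} | #|A| == s) (bad_sample A)%:R <=
  4 * ('C(n, s)%:R * tail).
Proof.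
have H1 := sum_bad_v_small; have H2 := sum_bad_u_large.
have H3 := sum_bad_v_large; have H4 := sum_bad_u_small.
apply: (@le_trans _ _ (\sum_(A : {set 'I_(size X)} | #|A| == s)
  ((bad_v_small A)%:R + (bad_u_large A)%:R + (bad_v_large A)%:R + (bad_u_small
    A)%:R))).
  apply: ler_sum => A _; rewrite -!natrD ler_nat /bad_sample.
  by do 4![case: (_ A)].
rewrite !big_split /=; lra.
Qed.

Variable A : {set 'I_(size X)}.
Hypothesis cA : #|A| = s.
Hypothesis goodA : ~~ bad_sample A.

Let S := sublist A.
Let u := nth x0 (sort <=%O S) iu.-1.
Let v := nth x0 (sort <=%O S) iv.-1.

Let szS : size S = s. Proof. by rewrite size_sublist. Qed.
Let iu0 : (0 < iu)%N. Proof. exact: idx_u_gt0. Qed.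
Let ius : (iu <= s)%N. Proof. exact: idx_u_le. Qed.
Let iuv : (iu <= iv)%N. Proof. exact: idx_u_le_v. Qed.
Let ivs : (iv <= s)%N. Proof. exact: idx_v_le. Qed.

Lemma pivots_le : (u <= v)%O.
Proof.
by apply: le_sorted_leq_nth => //; rewrite ?inE ?size_sort ?szS; lia.
Qed.

Let count_lt_u : (count (< u)%O S < iu)%N.
Proof. by have := count_lt_nth_sort x0 S iu.-1; rewrite -/u; lia. Qed.
Let count_le_u : (iu <= count (<= u)%O S)%N.
Proof. by have := @count_le_nth_sort _ _ x0 S iu.-1; rewrite -/u szS; lia. Qed.
Let count_lt_v : (count (< v)%O S < iv)%N.
Proof. by have := count_lt_nth_sort x0 S iv.-1; rewrite -/v; lia. Qed.
Let count_le_v : (iv <= count (<= v)%O S)%N.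
Proof. by have := @count_le_nth_sort _ _ x0 S iv.-1; rewrite -/v szS; lia. Qed.

(** If [v] were below the [k]th smallest element, so would be the at least [iv] sample elements up
    to [v], making the sample bad. The second alternative is where the clamp at [s] breaks
    [iv >= t + g]. *)
Lemma good_v_small : (k <= count (<= v)%O X)%N \/ s%:R < t + g.
Proof.
case: leqP => [|ltk]; [by left|right].
rewrite ltNge; apply/negP => tgs; move: goodA; rewrite !negb_or => /and4P[/negP + _
  _ _]; apply.
apply: le_trans (idx_v_ge tgs) _; rewrite -count_sublist ler_nat.
have vx : (v < xrank k.-1)%O by apply: nth_sort_gt; lia.
apply: (leq_trans count_le_v); apply: sub_count => y /=.
by move=> yv; apply: le_lt_trans yv vx.
Qed.

Lemma good_u_large : (count (< u)%O X < k)%N \/ t <= g.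
Proof.
case: ltnP => [|kle]; [by left|right].
rewrite leNgt; apply/negP => tgs; move: goodA; rewrite !negb_or => /and4P[_ /negP +
  _ _]; apply.
have ux : (xrank k.-1 < u)%O by apply: nth_sort_lt; lia.
apply/ltW/idx_u_lt => //; rewrite -count_sublist.
apply: leq_ltn_trans count_lt_u; apply: sub_count => y /=.
by move=> yv; apply: le_lt_trans yv ux.
Qed.

(** Otherwise [xrank jhigh < v], so fewer than [iv] sample elements are at most [xrank jhigh]. There
    is no exceptional case, since clamping only lowers [iv]. *)
Lemma good_v_large : (count (< v)%O X)%:R <= k%:R + 2 * q.
Proof.
have K0 : 0 <= k%:R + 2 * q by rewrite addr_ge0 // mulr_ge0.
rewrite leNgt -truncn_lt_nat // -/jhigh; apply/negP => jc.
move: goodA; rewrite !negb_or => /and4P[_ _ /negP + _]; apply.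
rewrite /bad_v_large (leq_trans jc (count_size _ _)) /=.
have ux : (xrank jhigh < v)%O by exact: nth_sort_lt.
apply/ltW/idx_v_lt; rewrite -count_sublist.
apply: leq_ltn_trans count_lt_v; apply: sub_count => y /=.
by move=> yv; apply: le_lt_trans yv ux.
Qed.

Lemma good_u_small : (count (> u)%O X)%:R <= (n - k)%:R + 2 * q.
Proof.
have K0 : 0 <= (n - k)%:R + 2 * q by rewrite addr_ge0 // mulr_ge0.
rewrite leNgt -truncn_lt_nat // -/jlow; apply/negP => jc.
move: goodA; rewrite !negb_or => /and4P[_ _ _ /negP +]; apply.
have jn : (jlow < n)%N := leq_trans jc (count_size _ _).
rewrite /bad_u_small jn /=.
have ux : (u < xrank (n - jlow.+1))%O.
  by apply: nth_sort_gt; rewrite ?count_le_gt; lia.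
apply: le_trans (idx_u_ge _ _ _ _ _ _) _; rewrite -count_sublist ler_nat.
apply: leq_trans count_le_u _; apply: sub_count => y /=.
by move=> yv; apply: le_lt_trans yv ux.
Qed.

Let rank_le (y : R) (m : nat) : m%:R * s%:R / n%:R <= y -> m%:R <= y * n%:R / s%:R.
Proof. by rewrite ler_pdivrMr // ler_pdivlMr. Qed.

(** A good sample allows this only when [t <= g], that is [k <= q]; then [L] lies below [v] and has
    at most [k + 2 * q] elements. *)
Lemma good_size_L : (k <= count (< u)%O X)%N -> (count (< u)%O X)%:R <= 4 * q.
Proof.
move=> kle; case: good_u_large => [|/rank_le kq]; first by rewrite ltnNge kle.
apply: (@le_trans _ _ (count (< v)%O X)%:R); last by have := good_v_large; have :=
  q0; rewrite -/q in kq; lra.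
rewrite ler_nat; apply: sub_count => y /= yu; exact: lt_le_trans yu pivots_le.
Qed.

Lemma good_size_R : (count (<= v)%O X < k)%N -> (count (> v)%O X)%:R <= 4 * q.
Proof.
move=> ltk; case: good_v_small => [|sgt]; first by rewrite leqNgt ltk.
have kle : (k <= n)%N by case/andP: kn.
have kq : (n - k)%:R <= q.
  apply: rank_le; rewrite natrB // mulrBl mulrBl mulrAC divff ?lt0r_neq0 // mul1r.
  by rewrite -/t; lra.
apply: (@le_trans _ _ (count (> u)%O X)%:R); last by have := good_u_small; have :=
  q0; lra.
rewrite ler_nat; apply: sub_count => y /= yu; exact: le_lt_trans pivots_le yu.
Qed.

(** When [u < v], every element is above [u] or below [v], so inclusion-exclusion gives
    [|M| + n <= (k + 2 * q) + (n - k + 2 * q)]. *)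
Lemma good_size_M : (count (fun x => (u < x)%O && (x < v)%O) X)%:R <= 4 * q.
Proof.
have kle : (k <= n)%N by case/andP: kn.
case: (ltP u v) => [uv|vu]; last first.
  have /eq_count -> : (fun x => (u < x)%O && (x < v)%O) =1 pred0; last first.
    by rewrite count_pred0; have := q0; lra.
  by move=> y; apply/negP => /andP[uy yv]; have := lt_le_trans (lt_trans uy yv) vu;
    rewrite ltxx.
have := good_u_small; have := good_v_large; rewrite natrB //.
suff : (count (fun x => (u < x)%O && (x < v)%O) X)%:R + n%:R <=
   (count (< v)%O X)%:R + (count (> u)%O X)%:R :> R by lra.
rewrite -!natrD ler_nat addnC [leqRHS]addnC -(count_predUI (> u)%O (< v)%O).
rewrite leq_add2r /n -count_predT; apply: sub_count => y _ /=.
by case: (ltP u y) => // yu; rewrite (le_lt_trans yu uv).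
Qed.

End Sampling.

(** * The recurrence for the expected cost *)

Lemma sum_draws_const (R : nmodType) (n s : nat) (c : R) :
  \sum_(A : {set 'I_n} | #|A| == s) c = c *+ 'C(n, s).
Proof.
rewrite -[in RHS](card_ord n) -card_draws -sumr_const.
by apply: eq_bigl => A; rewrite inE.
Qed.

Section Recurrence.
Variables (R : realType) (alpha beta eps eps_s : R).
Hypothesis alpha0 : 0 < alpha.
Variables (d : Order.disp_t) (T : orderType d).
Variable B : R -> R.
Hypothesis B_mono : forall y z, 0 <= y -> y <= z -> B y <= B z.
Hypothesis B_ge0 : forall y, 0 <= y -> 0 <= B y.

Let sz := ssize alpha eps_s.
Let gap_rank (n : nat) : R := sgap alpha beta eps eps_s n * n%:R / (sz n)%:R.

(** A bad sample still makes at most [2 * n] comparisons in Step 4 and recurses inside [X], so an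
    extra charge of [n + B n] covers it. *)
Lemma sel_round_le (cost : seq T -> nat -> R) (x0 : T) (X : seq T) (k : nat)
    (A : {set 'I_(size X)}) :
  (1 < size X)%N -> (1 <= k <= size X)%N -> #|A| = sz (size X) ->
  (forall Y j, (1 <= j <= size Y)%N -> cost Y j <= B (size Y)%:R) ->
  sel_round alpha beta eps eps_s cost x0 k A <=
    2 * B (sz (size X))%:R
    + ((size X)%:R + (minn k (size X - k))%:R + 2 * gap_rank (size X))
    + B (4 * gap_rank (size X))
    + (bad_sample alpha beta eps eps_s x0 k A)%:R * ((size X)%:R + B (size X)%:R).
Proof.
move=> n1 kn cA costB; rewrite /sel_round.
set iu := idx_u _ _ _ _ _ _; set iv := idx_v _ _ _ _ _ _.
set S := sublist A; set u := nth _ _ iu.-1; set v := nth _ _ iv.-1.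
have szS : size S = sz (size X) by rewrite size_sublist.
have iu0 : (0 < iu)%N by exact: idx_u_gt0.
have ius : (iu <= sz (size X))%N by exact: idx_u_le.
have ivs : (iv <= sz (size X))%N by exact: idx_v_le.
have q0 : 0 <= gap_rank (size X) by rewrite divr_ge0 ?mulr_ge0 // sqrtr_ge0.
have h1 : cost S iu <= B (sz (size X))%:R.
  by rewrite -szS; apply: costB; rewrite szS iu0.
have h2 : (if (iu < iv)%N then cost (drop iu (sort <=%O S)) (iv - iu)%N else 0) <=
    B (sz (size X))%:R.
  case: ifP => [uv|_]; last exact: B_ge0.
  have szD : size (drop iu (sort <=%O S)) = (sz (size X) - iu)%N.
    by rewrite size_drop size_sort szS.
  apply: le_trans (costB _ _ _) _; first by rewrite szD; lia.
  by apply: B_mono => //; rewrite ler_nat szD leq_subr.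
set c4 := (X in _ + X + _); set c7 := (X in _ + X <= _).
suff : c4 + c7 <= (size X)%:R + (minn k (size X - k))%:R + 2 * gap_rank (size X)
    + B (4 * gap_rank (size X))
    + (bad_sample alpha beta eps eps_s x0 k A)%:R * ((size X)%:R + B (size X)%:R).
  by move: h1 h2; lra.
(* The branches of Step 7 are analysed once, for use with [B n] on bad samples and [B (4 * q)] on
   good ones. *)
have c7_le (b : R) : 0 <= b ->
    ((k <= count (< u)%O X)%N -> B (count (< u)%O X)%:R <= b) ->
    ((count (<= v)%O X < k)%N -> B (count (> v)%O X)%:R <= b) ->
    B (count (fun x => (u < x)%O && (x < v)%O) X)%:R <= b -> c7 <= b.
  move=> b0 hL hR hM; rewrite /c7 !size_filter.
  have cle : (size X - count (> v)%O X)%N = count (<= v)%O X by rewrite count_le_gt.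
  have cgt : (count (fun x => v < x)%O X <= size X)%N by exact: count_size.
  case: ifP => // c1; case: ifP => // c2; case: ifP => c3.
    apply: le_trans (hL c3); rewrite -size_filter; apply: costB.
    by rewrite size_filter c3 andbT; case/andP: kn.
  case: ifP => c5.
    have c5' : (count (<= v)%O X < k)%N by rewrite -cle.
    apply: le_trans (hR c5'); rewrite -[in leRHS]size_filter; apply: costB.
    have ar (i m c : nat) :
      (1 <= i <= m -> m - c < i -> c <= m -> 0 < i - (m - c) <= c)%N by clear; lia.
    by rewrite size_filter; apply: ar kn c5 cgt.
  apply: le_trans hM; rewrite -[in leRHS]size_filter; apply: costB.
  have ar (i l e m r : nat) : (l < i <= l + e)%N = false ->
      (l + e + m < i <= r)%N = false -> (i <= l)%N = false -> (r < i)%N = false ->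
      (0 < i - (l + e) <= m)%N by clear; lia.
  by rewrite size_filter; apply: ar c1 c2 c3 c5.
case: (boolP (bad_sample _ _ _ _ _ _ _)) => [_|good]; rewrite ?mul1r ?mul0r ?addr0.
  have h4 : c4 <= 2 * (size X)%:R.
    by rewrite -natrM ler_nat mul2n step4_sum_le2.
  have h7 : c7 <= B (size X)%:R.
    by apply: c7_le => [|_|_|]; rewrite ?B_ge0 //; apply: B_mono; rewrite ?ler_nat
      ?count_size.
  have := B_ge0 (mulr_ge0 (ler0n R 4) q0); have := ler0n R (minn k (size X - k)).
  by move: q0 h4 h7; lra.
have h7 : c7 <= B (4 * gap_rank (size X)).
  apply: c7_le; first by rewrite B_ge0 // mulr_ge0.
  - by move=> kle; apply: B_mono => //; apply: (good_size_L alpha0 n1 kn cA good).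
  - by move=> kle; apply: B_mono => //; apply: (good_size_R alpha0 n1 kn cA good).
  - by apply: B_mono => //; apply: (good_size_M alpha0 n1 kn cA good).
suff h4 : c4 <= (size X)%:R + (minn k (size X - k))%:R + 2 * gap_rank (size X).
  by rewrite lerD.
have := step4_sum_le (size X) k u v A; rewrite -(ler_nat R) => H.
apply: le_trans H _; rewrite natrD -!addrA lerD2l; case: ifP => k2.
  rewrite (minn_idPl _); last by lia.
  exact: (good_v_large alpha0 n1 kn cA good).
rewrite (minn_idPr _); last by lia.
exact: (good_u_small alpha0 n1 kn cA good).
Qed.

Lemma sel_costS_le (f : nat) (X : seq T) (k : nat) :
  (1 < size X)%N -> (1 <= k <= size X)%N ->
  (forall (Y : seq T) j, (1 <= j <= size Y)%N ->
     sel_cost alpha beta eps eps_s f Y j <= B (size Y)%:R) ->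
  sel_cost alpha beta eps eps_s f.+1 X k <=
    (size X)%:R + (minn k (size X - k))%:R
    + (2 * B (sz (size X))%:R + 2 * gap_rank (size X) + B (4 * gap_rank (size X))
       + 4 * expR (- (sgap alpha beta eps eps_s (size X) ^+ 2 / (8 * (sz (size
         X))%:R)))
         * ((size X)%:R + B (size X)%:R)).
Proof.
case: X => [//|x0 X'] n1 kn costB; rewrite sel_costS leqNgt n1 [~~ _]/=.
move: n1 kn; set X := x0 :: X' => n1 kn.
have C0 : (0 : R) < 'C(size X, sz (size X))%:R by rewrite ltr0n bin_gt0 ltnW //
  ssize_lt.
rewrite ler_pdivrMr //.
apply: le_trans (ler_sum _ (fun A cA => sel_round_le x0 n1 kn (eqP cA) costB)) _.
rewrite big_split /= sum_draws_const -mulr_suml.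
have := sum_bad_sample beta eps eps_s alpha0 x0 n1 kn.
have nB : 0 <= (size X)%:R + B (size X)%:R by rewrite addr_ge0 // B_ge0.
move=> /(ler_wpM2r nB) H.
apply: le_trans (lerD (lexx _) H) _; rewrite -[X in X + _]mulr_natr -/sz.
by rewrite -[(size X').+1]/(size X) le_eqVlt; apply/orP; left; apply/eqP; ring.
Qed.

End Recurrence.

(** * A crude bound for lists of bounded size *)

Section CrudeBound.
Variables (R : realType) (alpha beta eps eps_s : R).

(* Uniform in the fuel, since recursive calls are on strictly shorter lists. *)
Lemma sel_cost_crude (N : nat) : exists2 c : R, 0 <= c &
  forall (d : Order.disp_t) (T : orderType d) (f : nat) (X : seq T) (k : nat),
    (size X <= N)%N -> sel_cost alpha beta eps eps_s f X k <= c.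
Proof.
elim: N => [|N [c c0 IH]].
  by exists 0 => // d T [|f] [|x X] k.
exists (3 * c + 2 * N.+1%:R); first by rewrite addr_ge0 ?mulr_ge0.
have cc0 : 0 <= 3 * c + 2 * N.+1%:R by rewrite addr_ge0 ?mulr_ge0.
move=> d T [//|f] [//|x0 X'] k; rewrite sel_costS; set X := x0 :: X' => szX.
case: leqP => // n1.
have C0 : (0 : R) < 'C(size X, ssize alpha eps_s (size X))%:R.
  by rewrite ltr0n bin_gt0 ltnW // ssize_lt.
rewrite ler_pdivrMr //.
apply: (@le_trans _ _ (\sum_(A : {set 'I_(size X)} | #|A| == ssize alpha eps_s
  (size X))
   (3 * c + 2 * N.+1%:R))).
  apply: ler_sum => A /eqP cA.
  apply: (@le_trans _ _ (3 * c + 2 * (size X)%:R)).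
    apply: sel_round_crude => //; rewrite ?mem_head ?cA ?ssize_lt //.
    by move=> Y j ltY; apply: IH; rewrite -ltnS (leq_trans ltY).
  by rewrite lerD2l ler_pM2l // ler_nat.
by rewrite sum_draws_const -[leLHS]mulr_natr.
Qed.

End CrudeBound.

(** * Growth of the sample size, the gap and the tail *)

Section Asymptotics.
Variables (R : realType) (alpha beta eps eps_s : R).
Hypotheses (alpha0 : 0 < alpha) (beta0 : 0 < beta) (eps0 : 0 < eps).
Hypothesis eps_lt : eps < eps_s.

Let eta := Num.max (1 + (eps - eps_s) / 2) eps_s.
Hypothesis eta1 : eta < 1.

Let eps_s_eta : eps_s <= eta. Proof. by rewrite le_max lexx orbT. Qed.
Let gap_eta : 1 + (eps - eps_s) / 2 <= eta. Proof. by rewrite le_max lexx. Qed.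
Let eta0 : 0 < eta.
Proof. exact: lt_le_trans (lt_trans eps0 eps_lt) eps_s_eta. Qed.
Let eps_s1 : eps_s < 1. Proof. exact: le_lt_trans eps_s_eta eta1. Qed.

Let sz := ssize alpha eps_s.
Let gap_rank (n : nat) : R := sgap alpha beta eps eps_s n * n%:R / (sz n)%:R.

Let natR_ge1 (n : nat) : (1 < n)%N -> 1 <= n%:R :> R.
Proof. by move=> n1; rewrite ler1n ltnW. Qed.

Let pow_ge1 (n : nat) (r : R) : (1 < n)%N -> 0 <= r -> 1 <= n%:R `^ r.
Proof. by move=> n1 r0; rewrite -[leLHS](powRr0 n%:R) ler_powR // natR_ge1. Qed.

Lemma int_pos_ceil_leD1 (y : R) : 0 <= y -> (int_pos (Num.ceil y))%:R <= y + 1.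
Proof.
move=> y0; case E : (int_pos _) => [|m]; first by rewrite addr_ge0.
by rewrite -natr1 lerD2r; apply/ltW; rewrite -lt_int_pos_ceil E.
Qed.

Lemma ssize_le_pow (n : nat) : (1 < n)%N -> (sz n)%:R <= (alpha + 1) * n%:R `^ eta.
Proof.
move=> n1; apply: (@le_trans _ _ (alpha * n%:R `^ eps_s + 1)).
  apply: le_trans (int_pos_ceil_leD1 _); last by rewrite mulr_ge0 ?powR_ge0 // ltW.
  by rewrite ler_nat geq_minl.
rewrite mulrDl mul1r lerD ?pow_ge1 //; last exact: ltW.
by rewrite ler_pM2l // ler_powR // natR_ge1.
Qed.

(** The [1 / 2] serves the case [s = n - 1], where [n - 1 >= n / 2] and [n >= n ^ eps_s]. *)
Lemma ssize_ge_pow (n : nat) : (1 < n)%N ->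
  Num.min alpha (1 / 2) * n%:R `^ eps_s <= (sz n)%:R.
Proof.
move=> n1; have p0 : 0 <= n%:R `^ eps_s := powR_ge0 _ _.
rewrite /sz /ssize; case: leqP => _.
  apply: le_trans (le_int_pos_ceil _).
  by rewrite ler_wpM2r // ge_min lexx.
apply: (@le_trans _ _ (1 / 2 * n%:R)); last first.
  have : 2 <= n%:R :> R by rewrite (ler_nat _ 2).
  by rewrite -subn1 natrB ?(ltnW n1) //; lra.
apply: ler_pM => //; first by rewrite le_min !ltW //; lra.
  by rewrite ge_min lexx orbT.
by rewrite ler1_powR ?natR_ge1 // ltW.
Qed.

Lemma sgap_sqr (n : nat) :
  sgap alpha beta eps eps_s n ^+ 2 = beta * (sz n)%:R * n%:R `^ eps.
Proof. by rewrite sqr_sqrtr // !mulr_ge0 ?powR_ge0 // ltW. Qed.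

(** Squaring gives [q ^ 2 = beta * n ^ (2 + eps) / s], and [s] is at least of order [n ^ eps_s];
    this is the source of the first term of [eta]. *)
Lemma gap_rank_le_pow (n : nat) : (1 < n)%N ->
  gap_rank n <= Num.sqrt (beta / Num.min alpha (1 / 2)) * n%:R `^ eta.
Proof.
move=> n1; set c := Num.min alpha (1 / 2).
have c0 : 0 < c by rewrite lt_min alpha0; lra.
have nR : (0 : R) < n%:R by rewrite ltr0n ltnW.
have sR : (0 : R) < (sz n)%:R by rewrite ltr0n ssize_gt0.
apply: (@le_trans _ _ (Num.sqrt (beta / c) * n%:R `^ (1 + (eps - eps_s) / 2)));
  last first.
  by rewrite ler_wpM2l ?sqrtr_ge0 // ler_powR // natR_ge1.
rewrite -(@ler_pXn2r _ 2) ?nnegrE //; last 2 first.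
- by rewrite divr_ge0 ?mulr_ge0 ?sqrtr_ge0.
- by rewrite mulr_ge0 ?sqrtr_ge0 ?powR_ge0.
have -> : gap_rank n ^+ 2 = beta * (sz n)%:R * n%:R `^ eps * n%:R ^+ 2 / (sz n)%:R
  ^+ 2.
  by rewrite /gap_rank !exprMn sgap_sqr exprVn.
have bc0 : 0 <= beta / c by rewrite divr_ge0 // ltW.
rewrite exprMn (sqr_sqrtr bc0) -(powR_mulrn 2 (powR_ge0 _ _)) -powRrM.
rewrite (_ : _ * 2%:R = 2%:R + eps - eps_s); last by lra.
have E : n%:R `^ (2%:R + eps - eps_s) * n%:R `^ eps_s = n%:R ^+ 2 * n%:R `^ eps.
  rewrite -powRD; last by rewrite lt0r_neq0 ?implybT.
  by rewrite subrK powRD ?powR_mulrn ?(ltW nR) // lt0r_neq0 ?implybT.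
have S := ssize_ge_pow n1; rewrite -/c in S.
have P0 : 0 <= n%:R `^ (2%:R + eps - eps_s) := powR_ge0 _ _.
rewrite [leLHS](_ : _ = beta * (n%:R ^+ 2 * n%:R `^ eps) / (sz n)%:R); last first.
  by field; rewrite lt0r_neq0.
rewrite -E ler_pdivrMr // [leRHS](_ : _ = beta * (n%:R `^ (2%:R + eps - eps_s) *
  ((sz n)%:R / c))); last first.
  by field; rewrite lt0r_neq0.
rewrite ler_pM2l // ler_wpM2l // ler_pdivlMr // mulrC //.
Qed.

(** The factor [s] cancels, leaving [expR (- y)] with [y = beta * n ^ eps / 8]. One term
    [y ^ (m + 1) / (m + 1)!] of the exponential series, with [eps * (m + 1) >= 1], already grows at
    least linearly in [n]. *)
Lemma tail_le_inv : exists2 C : R, 0 <= C & forall n : nat, (1 < n)%N ->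
  expR (- (sgap alpha beta eps eps_s n ^+ 2 / (8 * (sz n)%:R))) <= C / n%:R.
Proof.
pose m := Num.bound eps^-1.
have mP : 1 <= eps * m.+1%:R.
  rewrite mulrC -ler_pdivrMr // div1r ltW // (lt_le_trans (archi_boundP _))
    ?invr_ge0 ?(ltW eps0) //.
  by rewrite ler_nat.
pose D := (beta / 8) ^+ m.+1.
have D0 : 0 < D by rewrite exprn_gt0 // divr_gt0.
exists (m.+1`!%:R / D); first by rewrite divr_ge0 // ltW.
move=> n n1; have nR : (0 : R) < n%:R by rewrite ltr0n ltnW.
have sR : (0 : R) < (sz n)%:R by rewrite ltr0n ssize_gt0.
rewrite sgap_sqr (_ : beta * (sz n)%:R * n%:R `^ eps / (8 * (sz n)%:R) = beta / 8 *
  n%:R `^ eps); last first.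
  by field; rewrite lt0r_neq0.
have F0 : (0 : R) < m.+1`!%:R by rewrite ltr0n fact_gt0.
set y := beta / 8 * _.
have y0 : 0 <= y by rewrite mulr_ge0 ?powR_ge0 // divr_ge0 // ltW.
rewrite expRN -mulrA -invfM -[leRHS]invrK lef_pV2 ?posrE ?expR_gt0 //; last first.
  by rewrite invr_gt0 mulr_gt0 // invr_gt0 mulr_gt0.
apply: le_trans (expR_ge1Dxn m y0); rewrite invf_div.
apply: (@le_trans _ _ (y ^+ m.+1 / m.+1`!%:R)); last by rewrite lerDr.
rewrite ler_wpM2r ?invr_ge0 ?(ltW F0) // exprMn -/D ler_pM2l //.
rewrite -(powR_mulrn _ (powR_ge0 _ _)) -powRrM -[leLHS]powRr1 ?(ltW nR) //.
by rewrite ler_powR // natR_ge1.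
Qed.

(** Here [B] bounds the recursive calls, using [min (j, m - j) <= m / 2]. The constants do not
    depend on [G], so the final factor can be chosen after them. *)
Lemma recurrence_overhead : exists C1 C3 : R, [/\ 0 <= C1, 0 <= C3 &
  forall (G : R) (n : nat), 0 <= G -> (1 < n)%N ->
  let B y := 3 / 2 * y + G * y `^ eta in
  2 * B (sz n)%:R + 2 * gap_rank n + B (4 * gap_rank n)
    + 4 * expR (- (sgap alpha beta eps eps_s n ^+ 2 / (8 * (sz n)%:R)))
        * (n%:R + B n%:R)
  <= C1 * n%:R `^ eta + G * (C3 * n%:R `^ (eta * eta))].
Proof.
have [C2 C20 tailP] := tail_le_inv.
set K := Num.sqrt (beta / Num.min alpha (1 / 2)).
have K0 : 0 <= K := sqrtr_ge0 _.
(* The terms come from [2 * (3 / 2) * s], from [2 * q + (3 / 2) * (4 * q)], and from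
   [4 * (1 + 3 / 2)] times the tail bound. *)
exists (3 * (alpha + 1) + 8 * K + 10 * C2).
exists (2 * (alpha + 1) `^ eta + (4 * K) `^ eta + 4 * C2); split.
- by rewrite !addr_ge0 ?mulr_ge0 ?addr_ge0 // ltW.
- by rewrite !addr_ge0 ?mulr_ge0 ?powR_ge0.
move=> G n G0 n1; cbv zeta beta.
have nR : (0 : R) < n%:R by rewrite ltr0n ltnW.
have q0 : 0 <= gap_rank n by rewrite divr_ge0 ?mulr_ge0 // sqrtr_ge0.
have q1 := gap_rank_le_pow n1; rewrite -/K in q1.
have s1 := ssize_le_pow n1.
have t1 := tailP n n1.
have N1 : 1 <= n%:R `^ eta by rewrite pow_ge1 // ltW.
have N2 : 1 <= n%:R `^ (eta * eta) by rewrite pow_ge1 // mulr_ge0 // ltW.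
have e0 : 0 <= eta by exact: ltW.
have s2 : (sz n)%:R `^ eta <= (alpha + 1) `^ eta * n%:R `^ (eta * eta).
  rewrite powRrM -powRM ?powR_ge0 ?addr_ge0 ?(ltW alpha0) //.
  by apply: ge0_ler_powR => //; rewrite nnegrE ?mulr_ge0 ?powR_ge0 ?addr_ge0 ?(ltW
    alpha0).
have q2 : (4 * gap_rank n) `^ eta <= (4 * K) `^ eta * n%:R `^ (eta * eta).
  rewrite powRrM -powRM ?powR_ge0 ?mulr_ge0 //.
  apply: ge0_ler_powR => //; last by rewrite -mulrA ler_pM2l.
    by rewrite nnegrE mulr_ge0.
  by rewrite nnegrE !mulr_ge0 ?powR_ge0.
set P := expR _ in t1 *.
have P0 : 0 <= P := expR_ge0 _.
have t2 : P * n%:R <= C2 by rewrite -ler_pdivlMr.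
have t3 : P * n%:R `^ eta <= C2.
  by apply: le_trans t2; rewrite ler_wpM2l // ler1_powR ?natR_ge1 // ltW.
have c1 : C2 <= C2 * n%:R `^ eta by rewrite ler_peMr.
have c2 : C2 <= C2 * n%:R `^ (eta * eta) by rewrite ler_peMr.
have g1 := ler_wpM2l G0 s2; have g2 := ler_wpM2l G0 q2.
have g3 := ler_wpM2l G0 (le_trans t3 c2).
by move: g1 g2 g3 t2 c1 q1 s1; lra.
Qed.

(** As [0 < eta < 1], the exponent [eta - eta * eta] is positive, so the ratio of the two powers is
    unbounded. *)
Lemma pow_eta_sq_small (C : R) : 0 <= C -> exists N : nat, forall n : nat,
  (N < n)%N -> (1 < n)%N -> 2 * C * n%:R `^ (eta * eta) <= n%:R `^ eta.
Proof.
move=> C0; pose theta := eta - eta * eta.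
have th0 : 0 < theta by rewrite subr_gt0 -[ltRHS]mulr1 ltr_pM2l.
exists (Num.bound ((2 * C) `^ theta^-1)) => n Nn n1.
have nR : (0 : R) < n%:R by rewrite ltr0n ltnW.
rewrite -[in leRHS](subrK (eta * eta) eta) powRD; last by rewrite lt0r_neq0
  ?implybT.
rewrite ler_wpM2r ?powR_ge0 // -/theta.
have -> : 2 * C = ((2 * C) `^ theta^-1) `^ theta.
  by rewrite -powRrM mulVf ?lt0r_neq0 // powRr1 // mulr_ge0.
apply: ge0_ler_powR; rewrite ?nnegrE ?powR_ge0 ?(ltW th0) ?(ltW nR) //.
apply/ltW/(lt_trans (archi_boundP (powR_ge0 _ _))).
by rewrite ltr_nat.
Qed.

End Asymptotics.

(** * Choice of the constant and the final induction *)

Lemma minn_double_le (j m : nat) : ((minn j (m - j)).*2 <= m)%N.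
Proof. by lia. Qed.

Theorem theorem4p2 (R : realType) (alpha beta eps eps_s : R) :
  0 < alpha -> 0 < beta -> 0 < eps -> eps < eps_s ->
  Num.max (1 + (eps - eps_s) / 2) eps_s < 1 ->
  exists gamma : R, 0 < gamma /\
    forall (d : Order.disp_t) (T : orderType d) (X : seq T) (k : nat),
      (1 <= size X)%N -> (1 <= k <= size X)%N ->
      select_cost alpha beta eps eps_s X k <=
        (size X)%:R + (minn k (size X - k))%:R
        + gamma * ((size X)%:R `^ Num.max (1 + (eps - eps_s) / 2) eps_s).
Proof.
move=> alpha0 beta0 eps0 eps_lt eta1; set eta := Num.max _ _ in eta1 *.
have eta0 : 0 < eta by rewrite lt_max (lt_trans eps0 eps_lt) orbT.
have [C1 [C3 [C10 C30 over]]] := recurrence_overhead alpha0 beta0 eps0 eps_lt eta1.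
have [N smallN] := pow_eta_sq_small eps0 eps_lt eta1 C30.
have [c c0 crude] := sel_cost_crude alpha beta eps eps_s N.+1.
(* Half of [gamma] is to absorb [C1]; [c] covers the lists of size at most [N.+1]. *)
pose gamma := 2 * C1 + c + 1.
have gamma0 : 0 < gamma by rewrite ltr_wpDl // addr_ge0 // mulr_ge0.
exists gamma; split=> // d T X k _ kn; rewrite /select_cost.
(* The bound is proved for every fuel, so the induction needs no relation between the fuel and the
   lengths of the lists. *)
elim: (size X) {-2}X k kn => [|f IH] {}X k kn.
  by rewrite !addr_ge0 // mulr_ge0 ?powR_ge0 // ltW.
have n0 : (0 < size X)%N by case/andP: kn => k1; apply: leq_trans.
have pow1 : 1 <= (size X)%:R `^ eta.
  by rewrite -[leLHS](powRr0 (size X)%:R) ler_powR ?ler1n // ltW.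
case: (leqP (size X) N.+1) => [small|large].
  apply: (@le_trans _ _ gamma).
    by apply: le_trans (crude d T _ X k small) _; rewrite /gamma; move: C10; lra.
  apply: (@le_trans _ _ (gamma * (size X)%:R `^ eta)); first by rewrite ler_peMr //
    ltW.
  by rewrite lerDr addr_ge0.
have n1 : (1 < size X)%N := leq_ltn_trans (ltn0Sn N) large.
pose B (y : R) := 3 / 2 * y + gamma * y `^ eta.
have B_mono y z : 0 <= y -> y <= z -> B y <= B z.
  move=> y0 yz; apply: lerD; first by rewrite ler_pM2l // divr_gt0.
  rewrite ler_pM2l //; apply: ge0_ler_powR; rewrite ?nnegrE ?(ltW eta0) //.
  exact: le_trans yz.
have B_ge0 y : 0 <= y -> 0 <= B y.
  by move=> y0; rewrite addr_ge0 // mulr_ge0 ?powR_ge0 ?divr_ge0 // ltW.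
apply: le_trans (sel_costS_le alpha0 B_mono B_ge0 n1 kn _) _.
  move=> Y j jY; apply: le_trans (IH Y j jY) _; rewrite /B lerD2r.
  have := minn_double_le j (size Y); rewrite -(ler_nat R) -mul2n natrM.
  by move: (minn _ _)%:R (size Y)%:R => a b; clear; lra.
rewrite lerD2l; apply: le_trans (over gamma (size X) (ltW gamma0) n1) _.
(* One half of [gamma * n ^ eta] pays for the [C3] term, the other for the [C1] term. *)
have := ler_wpM2l (ltW gamma0) (smallN _ (ltnW large) n1).
have : 2 * C1 * (size X)%:R `^ eta <= gamma * (size X)%:R `^ eta.
  by rewrite ler_wpM2r ?powR_ge0 // /gamma -addrA lerDl addr_ge0.
by rewrite -/eta; lra.
Qed.
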